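(* Let $\{f_n\}_{n=1}^\infty$ be a sequence of real random variables on a probability space $(\Omega,\Sigma,\mathbb P)$. The following three conditions are equivalent: 1) $\{f_n\}\stackrel{\mathbb P}{\sim}\{r_n\}$; 2) there is a constant $C>0$ such that for all $t\in[1,\infty)$, $m\in\mathbb N$ and $a_1,\dots,a_m\in\mathbb R$, $$C^{-1}\Big\|\sum_{n=1}^m a_n r_n\Big\|_t\le\Big\|\sum_{n=1}^m a_n f_n\Big\|_t\le C\Big\|\sum_{n=1}^m a_n r_n\Big\|_t;$$ 3) there is a constant $\beta\ge1$ such that for all $t\in[1,\infty)$ and all finitely supported real sequences $a=(a_n)_{n\ge1}$, $$\beta^{-1}\mathcal K_{1,2}(\sqrt t,a)\le\Big\|\sum_{n} a_n f_n\Big\|_t\le\beta\,\mathcal K_{1,2}(\sqrt t,a).$$ Moreover, the constants in each of 1), 2), 3) can be chosen depending only on the constants in any other of these conditions; in particular, if for each $N$ a finite family $\{f_n\}_{n=1}^N$ satisfies 3) (for sequences supported in $\{1,\dots,N\}$) with a constant $\beta$ independent of $N$, then $\{f_n\}_{n=1}^N\stackrel{\mathbb P}{\sim}\{r_n\}_{n=1}^N$ with a constant independent of $N$.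
   Context: $\|f\|_p=(\mathbb E|f|^p)^{1/p}$. The Rademacher system is $r_n(x)=\operatorname{sign}\sin(2^{n-1}\pi x)$, $x\in[0,1]$, on $[0,1]$ with Lebesgue measure $|\cdot|$. Two systems $\{f_n\}$ on $(\Omega,\Sigma,\mathbb P)$ and $\{g_n\}$ on $(\Omega',\Sigma',\mathbb P')$ (finite or infinite, indexed by the same set) are equivalent in distribution, written $\{f_n\}\stackrel{\mathbb P}{\sim}\{g_n\}$, if there is $C>0$ (a constant of the equivalence) such that for all $m$, all real $a_1,\dots,a_m$ and all $z>0$: $C^{-1}\mathbb P\{|\sum_{n=1}^m a_nf_n|>Cz\}\le\mathbb P'\{|\sum_{n=1}^m a_ng_n|>z\}\le C\,\mathbb P\{|\sum_{n=1}^m a_nf_n|>C^{-1}z\}$. For a real sequence $a\in\ell_2$ and $t>0$, $\mathcal K_{1,2}(t,a)=\inf\{\|b\|_{\ell_1}+t\|c\|_{\ell_2}: a=b+c,\ b\in\ell_1,\ c\in\ell_2\}$ (Peetre's K-functional of the couple $(\ell_1,\ell_2)$). *)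

(* Defs.v *)
From HB Require Import structures.
From mathcomp Require Import all_boot all_order all_algebra.
From mathcomp Require Import all_classical all_reals all_analysis.
Set Implicit Arguments. Unset Strict Implicit. Unset Printing Implicit Defensive.
Import Order.TTheory GRing.Theory Num.Theory.
Import numFieldNormedType.Exports.
Local Open Scope classical_set_scope.
Local Open Scope ring_scope.

Section Defs.
Context {R : realType}.

Definition leb01 := @uniform_prob R 0 1 (@ltr01 R).

(* Rademacher system, indexed from 1: r_n(x) = sign sin(2^(n-1) pi x). *)
Definition rademacher (n : nat) (x : R) : R :=
  Num.sg (sin (2 ^+ n.-1 * pi * x)).

Definition psum {T : Type} (a : nat -> R) (f : nat -> T -> R) (m : nat) (x : T) : R :=
  \sum_(1 <= n < m.+1) a n * f n x.

Definition tnorm {d} {T : measurableType d} (P : probability T R) (t : R)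
  (g : T -> R) : \bar R := Lnorm P t%:E (EFin \o g).

(* Admissible lengths m: all m (infinite system, bound = None) or
   m <= N (finite system {f_n}_{n=1}^N, bound = Some N). *)
Definition admissible (bound : option nat) (m : nat) : Prop :=
  if bound is Some N then (m <= N)%N else True.

Definition dist_equiv_const {d d'} {T : measurableType d} {T' : measurableType d'}
  (P : probability T R) (f : nat -> T -> R)
  (P' : probability T' R) (g : nat -> T' -> R)
  (bound : option nat) (C : R) : Prop :=
  0 < C /\
  forall (m : nat) (a : nat -> R) (z : R), admissible bound m -> 0 < z ->
    ((C^-1)%:E * P [set x | (C * z < `|psum a f m x|)%R ]
       <= P' [set y | (z < `|psum a g m y|)%R ])%E /\
    (P' [set y | (z < `|psum a g m y|)%R ]
       <= C%:E * P [set x | (C^-1 * z < `|psum a f m x|)%R ])%E.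

Definition Lt_equiv_const {d} {T : measurableType d} (P : probability T R)
  (f : nat -> T -> R) (bound : option nat) (C : R) : Prop :=
  0 < C /\
  forall (t : R) (m : nat) (a : nat -> R), 1 <= t -> admissible bound m ->
    ((C^-1)%:E * tnorm leb01 t (psum a rademacher m)
       <= tnorm P t (psum a f m))%E /\
    (tnorm P t (psum a f m) <= C%:E * tnorm leb01 t (psum a rademacher m))%E.

Definition l1norm (b : nat -> R) : \bar R := (\sum_(0 <= n <oo) (`|b n|)%:E)%E.
Definition l2sq (c : nat -> R) : \bar R := (\sum_(0 <= n <oo) ((c n) ^+ 2)%:E)%E.

Definition K12 (t : R) (a : nat -> R) : \bar R :=
  ereal_inf [set v : \bar R | exists (b c : nat -> R),
     (forall n, a n = b n + c n) /\ (l1norm b < +oo)%E /\ (l2sq c < +oo)%E /\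
     v = (fine (l1norm b) + t * Num.sqrt (fine (l2sq c)))%:E].

Definition K_equiv_const {d} {T : measurableType d} (P : probability T R)
  (f : nat -> T -> R) (bound : option nat) (beta : R) : Prop :=
  1 <= beta /\
  forall (t : R) (m : nat) (a : nat -> R), 1 <= t -> admissible bound m ->
    a 0%N = 0 -> (forall n, (m < n)%N -> a n = 0) ->
    ((beta^-1)%:E * K12 (Num.sqrt t) a <= tnorm P t (psum a f m))%E /\
    (tnorm P t (psum a f m) <= beta%:E * K12 (Num.sqrt t) a)%E.

End Defs.

(* Main.v *)
Require Import Defs.
From HB Require Import structures.
From mathcomp Require Import all_boot all_order all_algebra.
From mathcomp Require Import all_classical all_reals all_analysis.
From mathcomp Require Import measurable_realfun ring lra.
Import Order.TTheory GRing.Theory Num.Theory.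
Import numFieldNormedType.Exports.
Local Open Scope classical_set_scope.
Local Open Scope ring_scope.

(** The Rademacher sum S = sum a_n r_n satisfies ||S||_t ~ K_{1,2}(sqrt t, a)
    for t >= 1, with universal constants.  For the upper bound, write a = b + c
    and N = |b|_1 + sqrt t |c|_2; then u^t <= e^(t(u-1)) with u = |S|/N reduces
    the claim to the product of the cosh (t a_n / N), each factor being at most
    exp (t |b_n| / N + 2 t^2 c_n^2 / N^2).  For the lower bound (t > 2), test S
    against the Riesz product prod (1 + b_n r_n), |b_n| <= 1, |b|_2 <= sqrt t:
    its norm in the dual exponent is at most e, and the supremum of
    sum a_n b_n over such b is K_{1,2}(sqrt t, a) by duality.  This gives
    2) <=> 3), and 1) => 2) is the layer-cake formula.  For 2) => 1), the moments
    of S double boundedly, ||S||_2t <= D ||S||_t, because K_{1,2} does; this is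
    inherited by sum a_n f_n, and tails of two variables with comparable doubling
    moments are comparable by the inequalities of Paley-Zygmund and Markov. *)

(** * Averages over signs, and the upper bound for Rademacher sums *)

Section RademacherAverage.
Context {R : realType} {I : Type}.
Implicit Types (l : seq I) (a b c : I -> R) (F G : R -> R) (x t : R).

(** Mean of [F] at [x] plus a sum of the [a i] with independent uniform signs. The starting point
    [x] is an argument so that inductions on [l] can shift it. *)
Fixpoint radE l a F x : R :=
  if l is i :: l' then (radE l' a F (x + a i) + radE l' a F (x - a i)) / 2
  else F x.

Lemma radE_le l a F G x : (forall y, F y <= G y) ->
  radE l a F x <= radE l a G x.
Proof.
by move=> FG; elim: l x => //= i l IH x; rewrite ler_pM2r// lerD.
Qed.

Lemma radED l a F G x :
  radE l a (fun y => F y + G y) x = radE l a F x + radE l a G x.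
Proof. by elim: l x => //= i l IH x; rewrite !IH; lra. Qed.

Lemma radEZ l a (k : R) F x :
  radE l a (fun y => k * F y) x = k * radE l a F x.
Proof. by elim: l x => //= i l IH x; rewrite !IH; lra. Qed.

Lemma radE_ge0 l a F x : (forall y, 0 <= F y) -> 0 <= radE l a F x.
Proof. by move=> F0; elim: l x => //= i l IH x; rewrite divr_ge0// addr_ge0. Qed.

(** Flipping all the signs at once preserves the mean. This is what later allows the first sign to
    be frozen. *)
Lemma radE_even l a F x : (forall y, F (- y) = F y) ->
  radE l a F (- x) = radE l a F x.
Proof.
move=> evF; elim: l x => //= i l IH x; rewrite addrC; congr (_ / 2).
by rewrite -(IH (x + _)) -(IH (x - _)); congr (radE l a F _ + radE l a F _); lra.
Qed.

Definition cosh x : R := (expR x + expR (- x)) / 2.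

Lemma radE_expR l a (k : R) x :
  radE l a (fun y => expR (k * y)) x = expR (k * x) * \prod_(i <- l) cosh (k * a i).
Proof.
elim: l x => [|i l IH] x /=; first by rewrite big_nil mulr1.
rewrite !IH big_cons /cosh mulrDr mulrBr !expRD; ring.
Qed.

Lemma expR_ler_inv x : x < 1 -> expR x <= (1 - x)^-1.
Proof.
move=> x1; rewrite -[expR x]invrK lef_pV2 ?posrE ?invr_gt0 ?expR_gt0 ?subr_gt0//.
by rewrite -expRN; exact: expR_ge1Dx.
Qed.

(* For |x| < 1/2, [expR x <= 1/(1-x)] gives [cosh x <= 1/(1-x^2)]; for larger
   x, [|x| <= 2 x^2]. *)
Lemma cosh_le x : cosh x <= expR (2 * x ^+ 2).
Proof.
have [x2|x2] := ltP `|x| 2^-1.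
  have /andP[xl xr] : - 2^-1 < x < 2^-1 by rewrite -ltr_norml.
  have h1 : expR x <= (1 - x)^-1 by apply: expR_ler_inv; lra.
  have h2 : expR (- x) <= (1 - - x)^-1 by apply: expR_ler_inv; lra.
  have h3 : cosh x <= (1 - x ^+ 2)^-1.
    apply: le_trans (_ : ((1 - x)^-1 + (1 - - x)^-1) / 2 <= _).
      by rewrite /cosh ler_pM2r// lerD.
    have e0 : 1 - x != 0 by lra.
    have e1 : 1 + x != 0 by lra.
    rewrite opprK le_eqVlt; apply/orP; left; apply/eqP.
    have e2 : 1 - x ^+ 2 != 0.
      by rewrite (_ : _ - _ = (1 - x) * (1 + x)) ?mulf_neq0//; ring.
    by field; rewrite e0 e1 e2.
  apply: (le_trans h3); apply: le_trans (expR_ge1Dx _).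
  have q : x ^+ 2 <= 4^-1 by nra.
  rewrite -[leLHS]mul1r ler_pdivrMr; last by lra.
  have := sqr_ge0 x; nra.
have nx : x <= `|x| by exact: ler_norm.
have nNx : - x <= `|x| by rewrite -normrN; exact: ler_norm.
have h : expR `|x| <= expR (2 * x ^+ 2).
  by rewrite ler_expR -real_normK ?num_real//; nra.
apply: le_trans h; rewrite /cosh ler_pdivrMr// mulr2n mulrDr mulr1.
by rewrite lerD// ler_expR.
Qed.

Lemma cosh_ge0 x : 0 <= cosh x.
Proof. by rewrite /cosh divr_ge0// addr_ge0// expR_ge0. Qed.

(** For the splitting a = b + c: the l_1 part enters the exponent linearly, the l_2 part
    quadratically. *)
Lemma cosh_leD x y : cosh (x + y) <= expR (`|x| + 2 * y ^+ 2).
Proof.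
rewrite expRD; apply: le_trans (_ : expR `|x| * cosh y <= _); last first.
  by rewrite ler_pM2l ?expR_gt0// cosh_le.
rewrite /cosh mulrA ler_pM2r// mulrDr opprD !expRD.
by rewrite lerD// ler_wpM2r ?expR_ge0// ler_expR ?ler_norm// -normrN ler_norm.
Qed.

Lemma powR_le_expR (u t : R) : 0 <= u -> 0 <= t -> u `^ t <= expR (t * (u - 1)).
Proof.
move=> u0 t0; rewrite mulrC expRM ge0_ler_powR ?nnegrE ?expR_ge0//.
by apply: le_trans (expR_ge1Dx _); lra.
Qed.

Definition radN t l a : R := (radE l a (fun y => `|y| `^ t) 0) `^ t^-1.

Lemma radN_ge0 t l a : 0 <= radN t l a. Proof. exact: powR_ge0. Qed.

Lemma radE_powR_ge0 t l a x : 0 <= radE l a (fun y => `|y| `^ t) x.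
Proof. by apply: radE_ge0 => y; exact: powR_ge0. Qed.

Lemma radE_powR_le l a b c t (N : R) : 1 <= t -> 0 < N ->
  (forall i, a i = b i + c i) ->
  \sum_(i <- l) `|b i| <= N -> t * \sum_(i <- l) c i ^+ 2 <= N ^+ 2 ->
  radE l a (fun y => `|y| `^ t) 0 <= (2 * expR 2 * N) `^ t.
Proof.
move=> t1 N0 abc bN cN; have t0 : 0 < t by lra.
have [k k0 kN] : exists2 k, 0 < k & k * N = t.
  by exists (t / N); rewrite ?divr_gt0// divfK// gt_eqF.
(* This is [powR_le_expR] at u = |y| / N, with k = t / N. Bounding e^(k|y|) by the sum of e^(ky) and
   e^(-ky) removes the absolute value, so that the mean factors over the signs. *)
have pt y : `|y| `^ t <=
    N `^ t * expR (- t) * (expR (k * y) + expR (- k * y)).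
  rewrite -[in leLHS](divfK (lt0r_neq0 N0) `|y|) powRM ?divr_ge0// ?(ltW N0)//.
  rewrite mulrC -mulrA ler_wpM2l ?powR_ge0//.
  apply: le_trans (powR_le_expR _ _ _ _) _; rewrite ?divr_ge0 ?(ltW N0) ?(ltW t0)//.
  rewrite mulrBr mulr1 addrC expRD ler_wpM2l ?expR_ge0//.
  have -> : t * (`|y| / N) = k * `|y| by rewrite -kN; field; rewrite gt_eqF.
  have [y0|y0] := leP 0 y.
    by rewrite ger0_norm// lerDl expR_ge0.
  by rewrite ltr0_norm// mulrN mulNr lerDr expR_ge0.
apply: le_trans (radE_le _ _ _ _ _ pt) _.
rewrite radEZ radED !radE_expR !mulr0 expR0 !mul1r.
(* In the exponent, k |b|_1 <= t and 2 k^2 |c|_2^2 <= 2 t, hence 3 t in total. *)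
have S k' : `|k'| = k -> \prod_(i <- l) cosh (k' * a i) <= expR (3 * t).
  move=> kk.
  apply: le_trans (_ : \prod_(i <- l) expR (k * `|b i| + 2 * (k * c i) ^+ 2) <= _).
    apply: ler_prod => i _; rewrite cosh_ge0/= abc mulrDr.
    apply: le_trans (cosh_leD _ _) _.
    rewrite normrM kk ler_expR lerD2l !exprMn ler_pM2l// ler_wpM2r ?sqr_ge0//.
    by rewrite -(real_normK (num_real k')) kk.
  rewrite -expR_sum ler_expR big_split/= -mulr_sumr.
  have -> : \sum_(i <- l) 2 * (k * c i) ^+ 2 = 2 * k ^+ 2 * \sum_(i <- l) c i ^+ 2.
    by rewrite mulr_sumr; apply: eq_bigr => i _; rewrite exprMn mulrA.
  have h1 : k * \sum_(i <- l) `|b i| <= t by rewrite -kN ler_pM2l.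
  suff h2 : k ^+ 2 * \sum_(i <- l) c i ^+ 2 <= t by lra.
  have : k ^+ 2 * (t * \sum_(i <- l) c i ^+ 2) <= k ^+ 2 * N ^+ 2.
    by rewrite ler_pM2l// exprn_gt0.
  rewrite -exprMn kN mulrCA expr2.
  by rewrite ler_pM2l.
have Sk : \prod_(i <- l) cosh (k * a i) <= expR (3 * t) by apply: S; rewrite gtr0_norm.
have SNk : \prod_(i <- l) cosh (- k * a i) <= expR (3 * t).
  by apply: S; rewrite normrN gtr0_norm.
(* The right-hand side absorbs this bound: e^(-t) e^(3t) = (e^2)^t, and 2 <= 2^t because t >= 1. *)
apply: le_trans (_ : N `^ t * expR (- t) * (2 * expR (3 * t)) <= _).
  by rewrite ler_wpM2l ?mulr_ge0 ?powR_ge0 ?expR_ge0//; lra.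
rewrite powRM ?mulr_ge0 ?expR_ge0 ?(ltW N0)// powRM ?expR_ge0//.
rewrite -expRM -mulrA mulrC ler_wpM2r ?powR_ge0//.
rewrite mulrCA -expRD (_ : - t + 3 * t = 2 * t); last by ring.
by rewrite ler_pM2r ?expR_gt0// le1r_powR//; lra.
Qed.

Lemma radN_le l a b c t : 1 <= t -> (forall i, a i = b i + c i) ->
  radN t l a <= 2 * expR 2 *
    (\sum_(i <- l) `|b i| + Num.sqrt t * Num.sqrt (\sum_(i <- l) c i ^+ 2)).
Proof.
move=> t1 abc; have t0 : 0 < t by lra.
set B := \sum_(i <- l) `|b i|; set s := Num.sqrt (\sum_(i <- l) _).
have B0 : 0 <= B by apply: sumr_ge0.
have s0 : 0 <= s by exact: sqrtr_ge0.
have t'0 : 0 <= Num.sqrt t by exact: sqrtr_ge0.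
have e0 : 0 < expR 2 :> R by exact: expR_gt0.
apply/ler_addgt0Pr => e e_gt0.
(* The extra term keeps [N] positive even when b and c both vanish on [l]. *)
pose N := B + Num.sqrt t * s + e / (2 * expR 2).
have N0 : 0 < N by rewrite ltr_wpDl ?divr_gt0 ?mulr_gt0// addr_ge0// mulr_ge0.
rewrite (_ : _ + e = 2 * expR 2 * N); last first.
  by rewrite /N [RHS]mulrDr; congr (_ + _); rewrite mulrC divfK// mulf_neq0// gt_eqF.
have N0' : 0 <= 2 * expR 2 * N by rewrite !mulr_ge0// ltW.
rewrite -[leRHS]powRr1// -[X in _ <= _ `^ X](divff (lt0r_neq0 t0)) powRrM /radN.
rewrite ge0_ler_powR ?nnegrE ?powR_ge0 ?radE_powR_ge0 ?invr_ge0 ?(ltW t0)//.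
have e'0 : 0 < e / (2 * expR 2) by rewrite divr_gt0// mulr_gt0.
apply: (@radE_powR_le _ _ b c) => //.
  by rewrite -/B /N -addrA lerDl addr_ge0 ?mulr_ge0// ltW.
have -> : \sum_(i <- l) c i ^+ 2 = s ^+ 2.
  by rewrite sqr_sqrtr// sumr_ge0// => i _; exact: sqr_ge0.
rewrite -{1}(sqr_sqrtr (ltW t0)) -exprMn ler_pXn2r ?nnegrE ?mulr_ge0 ?(ltW N0)//.
by rewrite /N; lra.
Qed.

End RademacherAverage.

(** * Riesz products *)

Section RieszProduct.
Context {R : realType}.
Implicit Types (x y s t p : R).

(* Young's inequality with exponents 1/s and 1/(1-s). *)
Lemma powR_bernoulli x s : 0 <= x -> 0 < s < 1 -> x `^ s <= 1 + s * (x - 1).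
Proof.
move=> x0 /andP[s0 s1].
have := @conjugate_powR R (x `^ s) 1 s^-1 (1 - s)^-1.
rewrite mulr1 -powRrM divff ?gt_eqF// powRr1// powR1 !invrK => h.
apply: le_trans (h _ _ _ _ _) _; rewrite ?powR_ge0 ?invr_gt0//; lra.
Qed.

(** Factor x^p as x times x^(p-1) and apply the Bernoulli bound to the exponent p - 1, which lies in
    (0, 1). *)
Lemma powR_le_sqr x p : 0 <= x -> 1 < p < 2 ->
  x `^ p <= (2 - p) * x + (p - 1) * x ^+ 2.
Proof.
move=> x0 /andP[p1 p2]; rewrite -mulr_powRB1//; last by lra.
apply: le_trans (_ : x * (1 + (p - 1) * (x - 1)) <= _).
  by rewrite ler_wpM2l// powR_bernoulli//; apply/andP; split; lra.
by rewrite le_eqVlt; apply/orP; left; apply/eqP; ring.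
Qed.

(* Hoelder's inequality for a two-point space and the density [1 + r b]. *)
Lemma two_point_holder (b x y t : R) : `|b| <= 1 -> 2 < t -> 0 <= x -> 0 <= y ->
  ((1 + b) * x `^ t^-1 + (1 - b) * y `^ t^-1) / 2 <=
  ((x + y) / 2) `^ t^-1 * expR (b ^+ 2 / t).
Proof.
rewrite ler_norml => /andP[b1 b2] t2 x0 y0.
have t0 : 0 < t by lra.
have t10 : 0 < t - 1 by lra.
pose p := t / (t - 1).
have p0 : 0 < p by rewrite divr_gt0.
have pt : t^-1 + p^-1 = 1.
  by rewrite /p; field; rewrite !gt_eqF.
have p1E : p - 1 = (t - 1)^-1 by rewrite /p; field; rewrite gt_eqF.
have p12 : 1 < p < 2.
  have : 0 < (t - 1)^-1 by rewrite invr_gt0.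
  have : (t - 1)^-1 < 1 by rewrite invf_lt1//; lra.
  by rewrite -p1E => *; apply/andP; split; lra.
have half : 2^-1 `^ t^-1 * 2^-1 `^ p^-1 = 2^-1 :> R.
  by rewrite -powRD pt ?powRr1// oner_eq0.
have w z : 0 <= z -> z `^ t^-1 / 2 = (z / 2) `^ t^-1 * 2^-1 `^ p^-1.
  by move=> z0; rewrite powRM// -mulrA half.
have -> : expR (b ^+ 2 / t) = expR ((p - 1) * b ^+ 2) `^ p^-1.
  by rewrite -expRM; congr expR; rewrite p1E /p; field; rewrite !gt_eqF.
rewrite mulrDl -!mulrA !w// mulrCA [X in _ + X]mulrCA.
have h2 : 0 <= 2^-1 `^ p^-1 :> R by exact: powR_ge0.
apply: le_trans (hoelder2 (powR_ge0 _ _) (powR_ge0 _ _) _ _ t0 p0 pt) _;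
  rewrite ?mulr_ge0//; [lra|lra|].
rewrite -!powRrM mulVf ?gt_eqF// !powRr1 ?divr_ge0// -mulrDl.
rewrite ler_wpM2l ?powR_ge0//.
rewrite ge0_ler_powR ?nnegrE ?invr_ge0 ?(ltW p0) ?expR_ge0// ?addr_ge0 ?powR_ge0//.
rewrite !powRM//; [|lra|lra].
rewrite -!powRrM mulVf ?gt_eqF// powRr1//.
have b1' : 0 <= 1 + b by lra.
have b2' : 0 <= 1 - b by lra.
(* Averaging the bounds at 1 + b and 1 - b gives (2 - p) + (p - 1)(1 + b^2) = 1 + (p - 1) b^2; here
   p < 2 comes from t > 2. *)
have := powR_le_sqr _ p b1' p12.
have := powR_le_sqr _ p b2' p12.
have := expR_ge1Dx ((p - 1) * b ^+ 2).
rewrite !expr2; nra.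
Qed.

Context {I : Type}.
Implicit Types (l : seq I) (a b c : I -> R).

(** The left side is the mean of the signed sum against the Riesz product. Hoelder's inequality is
    applied to one sign at a time, and the factors exp (b_i^2 / t) multiply up along the
    induction. *)
Lemma radE_riesz l a b t x : 2 < t -> (forall i, `|b i| <= 1) ->
  x + \sum_(i <- l) a i * b i <=
  radE l a (fun y => `|y| `^ t) x `^ t^-1 * expR ((\sum_(i <- l) b i ^+ 2) / t).
Proof.
move=> t2 b1; have t0 : 0 < t by lra.
elim: l x => [|i l IH] x /=.
  rewrite !big_nil mul0r expR0 mulr1 addr0 -powRrM divff ?gt_eqF// powRr1//.
  exact: ler_norm.
rewrite !big_cons [X in expR X]mulrDl expRD mulrA.
apply: le_trans (_ : ((1 + b i) * radE l a (fun y => `|y| `^ t) (x + a i) `^ t^-1 +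
   (1 - b i) * radE l a (fun y => `|y| `^ t) (x - a i) `^ t^-1) / 2 *
   expR ((\sum_(i <- l) b i ^+ 2) / t) <= _); last first.
  by rewrite ler_wpM2r ?expR_ge0// two_point_holder// radE_powR_ge0.
have := b1 i; rewrite ler_norml => /andP[bl br].
have bl' : 0 <= 1 + b i by lra.
have br' : 0 <= 1 - b i by lra.
have := ler_wpM2l bl' (IH (x + a i)).
have := ler_wpM2l br' (IH (x - a i)).
by lra.
Qed.

Lemma radN_ge_dual l a b t : 2 < t -> (forall i, `|b i| <= 1) ->
  \sum_(i <- l) b i ^+ 2 <= t ->
  \sum_(i <- l) a i * b i <= expR 1 * radN t l a.
Proof.
move=> t2 b1 bt; have t0 : 0 < t by lra.
have := radE_riesz l a b t 0 t2 b1; rewrite add0r => /le_trans; apply.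
by rewrite mulrC ler_wpM2r ?radN_ge0// ler_expR ler_pdivrMr// mul1r.
Qed.


End RieszProduct.

(** * Duality for the K-functional, and the lower bound *)

Section Decomposition.
Context {R : realType} {I : Type}.
Implicit Types (l : seq I) (a b c : I -> R) (k s t x : R).

Definition clip k x : R := if `|x| <= k then x else Num.sg x * k.

Lemma norm_clip k x : 0 <= k -> `|clip k x| = Num.min `|x| k.
Proof.
move=> k0; rewrite /clip; have [xk|xk] := leP `|x| k => //.
have x0 : x != 0 by rewrite -normr_gt0 (le_lt_trans k0).
by rewrite normrM normr_sg x0 mul1r ger0_norm.
Qed.

Lemma sqr_clip k x : 0 <= k -> clip k x ^+ 2 = Num.min `|x| k ^+ 2.
Proof. by move=> k0; rewrite -norm_clip// real_normK ?num_real. Qed.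

(** Equality here is what makes the truncation extremal in the duality: pairing with it recovers the
    l_1 norm of the remainder and the l_2 norm of the truncated part without loss. *)
Lemma mul_clip k x : 0 <= k -> x * clip k x = k * `|x - clip k x| + clip k x ^+ 2.
Proof.
move=> k0; rewrite /clip; have [xk|xk] := leP `|x| k.
  by rewrite subrr normr0 mulr0 add0r expr2.
have x0 : x != 0 by rewrite -normr_gt0 (le_lt_trans k0).
have sx : Num.sg x * `|x| = x by rewrite -numEsg.
have -> : `|x - Num.sg x * k| = `|x| - k.
  rewrite -{1}sx -mulrBr normrM normr_sg x0 mul1r ger0_norm//; lra.
have s2 : Num.sg x * Num.sg x = 1 by rewrite -expr2 sqr_sg x0.
have -> : x * (Num.sg x * k) = `|x| * k.
  by rewrite mulrA [x * _]mulrC -[X in _ * X * _]sx mulrA s2 mul1r.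
by rewrite exprMn expr2 s2; ring.
Qed.

Lemma continuous_sum_min_sqr l a s :
  continuous (fun k => \sum_(i <- l) Num.min `|a i| k ^+ 2 - s ^+ 2 * k ^+ 2).
Proof.
move=> k; apply: cvgB; last first.
  by apply: cvgM; [exact: cvg_cst|exact: exprn_continuous].
elim: l => [|i l IH].
  by under eq_fun do rewrite big_nil; rewrite big_nil; exact: cvg_cst.
under eq_fun do rewrite big_cons; rewrite big_cons; apply: cvgD => //.
have cm : (fun k => Num.min `|a i| k) @ k --> Num.min `|a i| k.
  by apply: (@continuous_min _ _ (fun=> `|a i|) id); [exact: cvg_cst|exact: cvg_id].
exact: (cvgM cm cm).
Qed.

(** As k grows from 0, the sum of min(|a_i|, k)^2 / k^2 decreases from the number of nonzero a_i
    towards 0. Either that number is at most s^2, or the value s^2 is attained. *)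
Lemma clip_threshold l a s : 0 < s ->
  (\sum_(i <- l) Num.sg (a i) ^+ 2 <= s ^+ 2) \/
  exists2 k, 0 < k & \sum_(i <- l) Num.min `|a i| k ^+ 2 = s ^+ 2 * k ^+ 2.
Proof.
move=> s0.
have [[k k0 hk]|noK] := pselect (exists2 k, 0 < k &
    s ^+ 2 * k ^+ 2 <= \sum_(i <- l) Num.min `|a i| k ^+ 2); last first.
  left.
  have [k k0 ak] : exists2 k, 0 < k &
      \sum_(i <- l) Num.sg (a i) ^+ 2 * k ^+ 2 <= \sum_(i <- l) Num.min `|a i| k ^+ 2.
    (* Any k below all the nonzero |a_i| works; the bound is kept for all smaller k' so that the
       induction can shrink the threshold. *)
    have [k k0 ak] : exists2 k, 0 < k & forall k', 0 < k' <= k ->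
      \sum_(i <- l) Num.sg (a i) ^+ 2 * k' ^+ 2 <= \sum_(i <- l) Num.min `|a i| k' ^+ 2.
      elim: l {noK} => [|i l [k k0 IH]].
        by exists 1 => // k' _; rewrite !big_nil.
      have [ai0|ai0] := eqVneq (a i) 0.
        exists k => // k' k'k; rewrite !big_cons lerD ?IH//.
        by rewrite ai0 sgr0 expr0n mul0r sqr_ge0.
      exists (Num.min k `|a i|); first by rewrite lt_min k0 normr_gt0.
      move=> k' /andP[k'0]; rewrite le_min => /andP[k'k k'a].
      rewrite !big_cons lerD ?IH ?k'0 ?k'k//.
      by rewrite sqr_sg ai0 mul1r min_r.
    by exists k => //; apply: ak; rewrite k0 lexx.
  have : ~ (s ^+ 2 * k ^+ 2 <= \sum_(i <- l) Num.min `|a i| k ^+ 2).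
    by move=> h; apply: noK; exists k.
  move/negP; rewrite -ltNge => /(le_lt_trans ak).
  by rewrite -mulr_suml ltr_pM2r ?exprn_gt0// => /ltW.
right.
pose g k := \sum_(i <- l) Num.min `|a i| k ^+ 2 - s ^+ 2 * k ^+ 2.
pose S := \sum_(i <- l) `|a i| ^+ 2.
have S0 : 0 <= S by apply: sumr_ge0 => i _; exact: sqr_ge0.
(* Chosen so that s K is at least the l_2 norm of a, which forces [g K <= 0]. *)
pose K := k + Num.sqrt S / s.
have kK : k <= K by rewrite lerDl divr_ge0// ltW.
have gk : 0 <= g k by rewrite subr_ge0.
have gK : g K <= 0.
  rewrite subr_le0; apply: le_trans (_ : S <= _).
    apply: ler_sum => i _; rewrite ler_pXn2r ?nnegrE ?le_min ?normr_ge0//=.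
      by rewrite ge_min lexx.
    by rewrite (le_trans _ kK)// ltW.
  rewrite -(sqr_sqrtr S0) -exprMn ler_pXn2r ?nnegrE//; last first.
    by rewrite mulr_ge0 ?(le_trans _ kK)// ltW.
  rewrite /K mulrDr mulrCA divff ?gt_eqF// mulr1 lerDr mulr_ge0// ltW//.
have [//||k' k'k gk'0] := @IVT R g k K 0 kK.
- by apply: continuous_subspaceT; exact: continuous_sum_min_sqr.
- by rewrite ge_min gK orbT le_max gk.
exists k'; last by apply/eqP; rewrite -subr_eq0; apply/eqP.
by move: k'k; rewrite in_itv/= => /andP[kk' _]; exact: lt_le_trans kk'.
Qed.

(* The K-functional of (l_1, l_2) is dual to [max (|b|_oo, |b|_2 / s)]; an
   extremal functional is [clip k a / k], where the threshold [k] is tuned so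
   that its l_2-norm is [s]. *)
Lemma K_dual l a s : 0 < s -> exists b c d : I -> R,
  [/\ forall i, a i = b i + c i, forall i, `|d i| <= 1,
      \sum_(i <- l) d i ^+ 2 <= s ^+ 2 &
      \sum_(i <- l) `|b i| + s * Num.sqrt (\sum_(i <- l) c i ^+ 2) <=
      \sum_(i <- l) a i * d i].
Proof.
move=> s0; have [sg_le|[k k0 kE]] := clip_threshold l a s s0.
  (* With at most s^2 nonzero entries the sign vector is admissible, and everything goes into the
     l_1 part. *)
  exists a, (fun=> 0), (Num.sg \o a); split => //=.
  - by move=> i; rewrite addr0.
  - by move=> i; rewrite normr_sg lern1; case: eqP.
  - rewrite [X in Num.sqrt X]big1 => [|i _]; last by rewrite expr0n.
    rewrite sqrtr0 mulr0 addr0 ler_sum// => i _.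
    by rewrite mulrC -normrEsg.
pose c i := clip k (a i).
have cE : \sum_(i <- l) c i ^+ 2 = (s * k) ^+ 2.
  by rewrite exprMn -kE; apply: eq_bigr => i _; rewrite sqr_clip// ltW.
exists (fun i => a i - c i), c, (fun i => c i / k); split => /=.
- by move=> i; rewrite subrK.
- move=> i; rewrite normrM normfV (gtr0_norm k0) ler_pdivrMr// mul1r.
  by rewrite norm_clip ?(ltW k0)// ge_min lexx orbT.
- under eq_bigr do rewrite exprMn.
  by rewrite -mulr_suml cE exprMn -mulrA -exprMn divff ?gt_eqF// expr1n mulr1.
rewrite cE sqrtr_sqr ger0_norm ?mulr_ge0 ?(ltW k0) ?(ltW s0)//.
(* By [mul_clip] divided by k; the last sum over k is s^2 k, that is, s times the l_2 norm s k of
   c. *)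
have -> : \sum_(i <- l) a i * (c i / k) =
    \sum_(i <- l) `|a i - c i| + (\sum_(i <- l) c i ^+ 2) / k.
  rewrite mulr_suml -big_split/=; apply: eq_bigr => i _.
  by rewrite /c mulrA mul_clip ?(ltW k0)//; field; rewrite gt_eqF.
rewrite cE lerD2l le_eqVlt; apply/orP; left; apply/eqP.
by field; rewrite gt_eqF.
Qed.

Lemma radE_sqr l a x :
  radE l a (fun y => y ^+ 2) x = x ^+ 2 + \sum_(i <- l) a i ^+ 2.
Proof.
elim: l x => [|i l IH] x /=; first by rewrite big_nil addr0.
by rewrite !IH big_cons; field.
Qed.

(** The right side is the fourth moment of x plus a centred Gaussian of the same variance; each sign
    contributes 2 a_i^4 less than its Gaussian counterpart. *)
Lemma radE_pow4 l a x : radE l a (fun y => y ^+ 4) x <=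
  x ^+ 4 + 6 * x ^+ 2 * (\sum_(i <- l) a i ^+ 2) + 3 * (\sum_(i <- l) a i ^+ 2) ^+ 2.
Proof.
elim: l x => [|i l IH] x /=; first by rewrite big_nil expr0n !mulr0 !addr0.
rewrite big_cons.
set S := \sum_(j <- l) _.
apply: le_trans (_ : ((x + a i) ^+ 4 + 6 * (x + a i) ^+ 2 * S + 3 * S ^+ 2 +
  ((x - a i) ^+ 4 + 6 * (x - a i) ^+ 2 * S + 3 * S ^+ 2)) / 2 <= _).
  by rewrite ler_pM2r// lerD.
rewrite -subr_ge0.
rewrite (_ : _ - _ = 2 * (a i ^+ 2) ^+ 2); first by rewrite mulr_ge0// sqr_ge0.
by field.
Qed.

(* The pointwise bound [y^2 <= L^(2-t) |y|^t + y^4 / L^2] with [L] three times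
   the l_2-norm, so that the fourth moment absorbs less than half of the second. *)
Lemma radN_ge_l2 l a t : 1 <= t <= 2 ->
  2 / 9 * Num.sqrt (\sum_(i <- l) a i ^+ 2) <= radN t l a.
Proof.
move=> /andP[t1 t2]; set S := \sum_(i <- l) _.
have S0 : 0 <= S by apply: sumr_ge0 => i _; exact: sqr_ge0.
set s := Num.sqrt S; have sE : s ^+ 2 = S by rewrite sqr_sqrtr.
have : 0 <= s by exact: sqrtr_ge0.
rewrite le_eqVlt => /predU1P[<-|s_gt0]; first by rewrite mulr0 radN_ge0.
have t0 : 0 < t by lra.
pose L := 3 * s; have L0 : 0 < L by rewrite mulr_gt0.
have pt y : y ^+ 2 <= L ^+ 2 / L `^ t * `|y| `^ t + (L ^+ 2)^-1 * y ^+ 4.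
  have [yL|Ly] := leP `|y| L.
    apply: le_trans (_ : L ^+ 2 / L `^ t * `|y| `^ t <= _); last first.
      rewrite lerDl mulr_ge0 ?invr_ge0 ?sqr_ge0//.
      by rewrite (_ : 4 = 2 * 2)%N// exprM sqr_ge0.
    have [->|y0] := eqVneq y 0.
      by rewrite expr0n/= mulr_ge0 ?divr_ge0 ?sqr_ge0 ?powR_ge0.
    have yp : 0 < `|y| by rewrite normr_gt0.
    rewrite -(real_normK (num_real y)) -!powR_mulrn ?(ltW L0)//.
    rewrite -!powRB; last by rewrite (gt_eqF L0) implybT.
    rewrite -ler_pdivrMr ?powR_gt0// -powRB; last by rewrite (gt_eqF yp) implybT.
    by rewrite ge0_ler_powR ?nnegrE ?(ltW L0) ?(ltW yp)//; lra.
  have hL : L ^+ 2 <= y ^+ 2.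
    by rewrite -[leRHS](real_normK (num_real y)) ler_pXn2r ?nnegrE ?(ltW L0) ?(ltW Ly).
  apply: le_trans (_ : (L ^+ 2)^-1 * y ^+ 4 <= _); last first.
    by rewrite lerDr mulr_ge0 ?divr_ge0 ?sqr_ge0 ?powR_ge0.
  rewrite mulrC ler_pdivlMr ?exprn_gt0// (_ : y ^+ 4 = y ^+ 2 * y ^+ 2); last by ring.
  by rewrite ler_wpM2l ?sqr_ge0.
have := radE_le l a _ _ 0 pt; rewrite radED !radEZ radE_sqr.
set E := radE l a _ 0.
have := radE_pow4 l a 0; rewrite -/S -sE !expr0n/= mulr0 mul0r !add0r.
set F := radE l a _ 0 => hF hE.
have hF' : (L ^+ 2)^-1 * F <= s ^+ 2 / 3.
  rewrite mulrC ler_pdivrMr ?exprn_gt0//; apply: (le_trans hF).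
  by rewrite /L le_eqVlt; apply/orP; left; apply/eqP; field.
have hE' : 2 / 27 * L `^ t <= E.
  have : 2 / 3 * s ^+ 2 <= L ^+ 2 / L `^ t * E by lra.
  rewrite (_ : 2 / 3 * s ^+ 2 = L ^+ 2 * (2 / 27)); last by rewrite /L; field.
  by rewrite -[leRHS]mulrA ler_pM2l ?exprn_gt0// ler_pdivlMl ?powR_gt0// mulrC.
(* Since 2/27 < 1 and t >= 1, the power (2/27)^t is at most 2/27, so [hE'] suffices. *)
have -> : 2 / 9 * s = ((2 / 27 * L) `^ t) `^ t^-1.
  rewrite -powRrM divff ?gt_eqF// powRr1; last by rewrite /L; lra.
  by rewrite /L; field.
rewrite /radN ge0_ler_powR ?nnegrE ?powR_ge0 ?invr_ge0 ?(ltW t0) ?radE_powR_ge0//.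
apply: le_trans hE'; rewrite powRM ?(ltW L0)//.
by rewrite ler_wpM2r ?powR_ge0// ge1r_powR//; lra.
Qed.

(** For t <= 2 the choice b = 0, c = a loses sqrt t * 9/2 <= 9; for t > 2 the dual decomposition and
    the Riesz product lose e <= 4. *)
Lemma radN_ge l a t : 1 <= t -> exists b c : I -> R,
  (forall i, a i = b i + c i) /\
  \sum_(i <- l) `|b i| + Num.sqrt t * Num.sqrt (\sum_(i <- l) c i ^+ 2) <=
    9 * radN t l a.
Proof.
move=> t1; have t0 : 0 < t by lra.
have [t2|t2] := leP t 2.
  exists (fun=> 0), a; split => [i|]; first by rewrite add0r.
  rewrite big1 ?add0r; last by move=> i _; rewrite normr0.
  have := radN_ge_l2 l a t; rewrite t1 t2 => /(_ isT).
  set s := Num.sqrt (\sum_(i <- l) _) => h.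
  have : 0 <= s by exact: sqrtr_ge0.
  have : Num.sqrt t <= 2.
    by rewrite -[leRHS]ger0_norm// -sqrtr_sqr ler_sqrt ?exprn_ge0//; lra.
  nra.
have st0 : 0 < Num.sqrt t by rewrite sqrtr_gt0.
have [b [c [d [abc d1 dt h]]]] := K_dual l a _ st0.
exists b, c; split => //; apply: (le_trans h).
rewrite sqr_sqrtr ?(ltW t0)// in dt.
apply: le_trans (radN_ge_dual l a d t t2 d1 dt) _.
rewrite ler_wpM2r ?radN_ge0//.
have e2 : expR 2^-1 <= 2 :> R.
  apply: le_trans (expR_ler_inv _ _) _; first by lra.
  by rewrite (_ : 1 - 2^-1 = 2^-1) ?invrK//; lra.
have -> : 1 = 2^-1 + 2^-1 :> R by lra.
by rewrite expRD; have := @expR_gt0 R 2^-1; nra.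
Qed.

End Decomposition.

(** * Moments from tails *)

Section MomentsOfTails.
Context {R : realType}.
Local Open Scope ereal_scope.

Lemma integral_layer_cake d (T : measurableType d) (P : probability T R)
    (g : T -> R) : measurable_fun setT g -> (forall x, 0 <= g x)%R ->
  measurable_fun setT (fun r : R => P [set x | (r < g x)%R]) /\
  \int[P]_x (g x)%:E =
  \int[@lebesgue_measure R]_(r in `]0%R, +oo[) P [set x | (r < g x)%R].
Proof.
move=> mg g0.
pose X : {RV P >-> R} := HB.pack g (isMeasurableFun.Build _ _ _ _ g mg).
have XE : ccdf X = fun r => P [set x | (r < g x)%R].
  apply/funext => r; rewrite /ccdf /distribution /pushforward; congr (P _).
  by apply/seteqP; split => x /=; rewrite in_itv/= andbT.
have mX : measurable_fun setT (ccdf X) by exact: ccdf_measurable.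
split; first by rewrite -XE.
rewrite -XE integral_itv_obnd_cbnd; last exact: measurable_funTS.
by rewrite -ge0_expectation_ccdf// unlock.
Qed.

Lemma measurable_gt d (T : measurableType d) (g : T -> R) (z : R) :
  measurable_fun setT g -> measurable [set x | (z < g x)%R].
Proof.
move=> mg.
rewrite (_ : [set x | _] = setT `&` g @^-1` `]z, +oo[%classic); last first.
  by rewrite setTI; apply/seteqP; split => x /=; rewrite in_itv/= andbT.
exact: mg.
Qed.

Lemma measurable_norm_powR d (T : measurableType d) (g : T -> R) (t : R) :
  measurable_fun setT g -> measurable_fun setT (fun x => `|g x| `^ t)%R.
Proof.
by move=> mg; apply: (measurableT_comp (measurable_powR _)) => //; exact: measurableT_comp.
Qed.

Lemma tnormE d (T : measurableType d) (P : probability T R) (t : R) (g : T -> R) :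
  tnorm P t g = (\int[P]_x (`|g x| `^ t)%:E) `^ t^-1.
Proof.
by rewrite /tnorm unlock.
Qed.

Lemma tnorm_ge0 d (T : measurableType d) (P : probability T R) (t : R) (g : T -> R) :
  0 <= tnorm P t g.
Proof. by rewrite tnormE poweR_ge0. Qed.

Lemma tnorm_le_tail d d' (T : measurableType d) (T' : measurableType d')
    (P : probability T R) (P' : probability T' R) (X : T -> R) (Y : T' -> R)
    (C t : R) : measurable_fun setT X -> measurable_fun setT Y ->
  (0 < C)%R -> (1 <= t)%R ->
  (forall z, (0 < z)%R ->
    P' [set y | (z < `|Y y|)%R] <= C%:E * P [set x | (C^-1 * z < `|X x|)%R]) ->
  tnorm P' t Y <= (Num.max 1 C * C)%:E * tnorm P t X.
Proof.
move=> mX mY C0 t1 tail.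
have t0 : (0 < t)%R by exact: lt_le_trans t1.
(* The dilation in the tail bound is absorbed into X: C^-1 z < |X| means z < |C X|. The layer-cake
   formulas are then compared at r = z^t. *)
pose g x := (`|C * X x| `^ t)%R.
have mg : measurable_fun setT g.
  by apply: measurable_norm_powR; apply: measurable_funM.
have gE x : g x = (C `^ t * `|X x| `^ t)%R.
  by rewrite /g normrM gtr0_norm// powRM// ltW.
have [mlX lX] := @integral_layer_cake _ _ P g mg (fun=> powR_ge0 _ _).
have [mlY lY] := @integral_layer_cake _ _ P' _ (measurable_norm_powR _ _ _ t mY)
  (fun=> powR_ge0 _ _).
have le_int : \int[P']_y (`|Y y| `^ t)%:E <= C%:E * \int[P]_x (g x)%:E.
  rewrite lX lY -ge0_integralZl//=; last 2 first.
  - exact: measurable_funTS.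
  - by rewrite lee_fin ltW.
  apply: ge0_le_integral => //=.
  - exact: measurable_funTS.
  - by apply: measurable_funeM; exact: measurable_funTS.
  move=> r; rewrite in_itv/= andbT => r0.
  have pow_lt (u : R) : (0 <= u)%R -> (r < u `^ t)%R = (r `^ t^-1 < u)%R.
    move=> u0; have rE : r = ((r `^ t^-1) `^ t)%R.
      by rewrite -powRrM mulVf ?gt_eqF// powRr1// ltW.
    rewrite {1}rE; apply/idP/idP; last by apply: gt0_ltr_powR; rewrite ?nnegrE ?powR_ge0.
    apply: contraTT; rewrite -!leNgt => h.
    by apply: ge0_ler_powR; rewrite ?nnegrE ?powR_ge0 ?(ltW t0).
  have r'0 : (0 < r `^ t^-1)%R by rewrite powR_gt0.
  have -> : [set y | (r < `|Y y| `^ t)%R] = [set y | (r `^ t^-1 < `|Y y|)%R].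
    by apply/seteqP; split => y /=; rewrite pow_lt.
  have -> : [set x | (r < g x)%R] = [set x | (C^-1 * r `^ t^-1 < `|X x|)%R].
    apply/seteqP; split => x /=; rewrite /g pow_lt// normrM gtr0_norm//;
      by rewrite ltr_pdivrMl.
  exact: tail.
rewrite !tnormE.
have iX0 : 0 <= \int[P]_x (`|X x| `^ t)%:E by apply: integral_ge0.
apply: le_trans (_ : (C%:E * ((C `^ t)%:E * \int[P]_x (`|X x| `^ t)%:E)) `^ t^-1 <= _).
  apply: gt0_ler_poweR; rewrite ?invr_ge0 ?(ltW t0)//.
  - by rewrite in_itv/= leey andbT integral_ge0.
  - by rewrite in_itv/= leey andbT !mule_ge0 ?lee_fin ?powR_ge0 ?(ltW C0).
  apply: (le_trans le_int); rewrite lee_pmul2l ?lte_fin//.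
  rewrite -ge0_integralZl//=; last 2 first.
  - by apply/measurable_EFinP; exact: measurable_norm_powR.
  - by rewrite lee_fin powR_ge0.
  by under eq_integral do rewrite gE EFinM.
rewrite !poweRM ?mule_ge0 ?lee_fin ?powR_ge0 ?(ltW C0)// !poweR_EFin.
rewrite -powRrM divff ?gt_eqF// powRr1 ?(ltW C0)// muleA.
apply: lee_wpmul2r; first exact: poweR_ge0.
rewrite -EFinM lee_fin ler_pM2r// le_max.
(* The factor C^(1/t) is at most C if C >= 1 and at most 1 otherwise, uniformly in t >= 1. *)
have [C1|C1] := leP 1%R C; first by rewrite ler1_powR ?orbT// invf_le1.
apply/orP; left; apply: le_trans (_ : (1 `^ t^-1 <= 1)%R); last by rewrite powR1.
by rewrite ge0_ler_powR ?nnegrE ?invr_ge0 ?(ltW t0) ?(ltW C0) ?(ltW C1).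
Qed.

End MomentsOfTails.

(** * The joint law of the Rademacher functions *)

Section RademacherLaw.
Context {R : realType}.
Implicit Types (a : nat -> R) (F : R -> R) (x u v w t : R).
Local Notation mu := (@lebesgue_measure R).

(** With y the relative position of x in its dyadic interval, the argument of the sine is pi y + k
    pi, and each shift by pi changes the sign. *)
Lemma rademacher_itv (n k : nat) x :
  k%:R / 2 ^+ n < x < k.+1%:R / 2 ^+ n -> rademacher n.+1 x = (-1) ^+ k.
Proof.
have p0 : 0 < 2 ^+ n :> R by rewrite exprn_gt0.
rewrite ltr_pdivrMr// ltr_pdivlMr// => /andP[kx xk].
pose y := x * 2 ^+ n - k%:R.
rewrite /rademacher/= (_ : _ * x = pi * y + pi *+ k); last first.
  by rewrite /y -mulr_natr; ring.
have pi0 := @pi_gt0 R.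
rewrite alternatingn; last exact: sinDpi.
rewrite sgrM [X in _ * X]gtr0_sg ?mulr1.
  by rewrite sgrX sgrN1.
rewrite sin_gt0_pi// mulr_gt0//= ?subr_gt0//.
by rewrite gtr_pMr// ltrBlDr nat1r.
Qed.

Lemma measurable_rademacher (n : nat) : measurable_fun setT (@rademacher R n).
Proof.
have ms : measurable_fun setT (fun x : R => sin (2 ^+ n.-1 * pi * x)).
  apply: (@measurableT_comp _ _ _ _ _ _ (@sin R)).
    by apply: continuous_measurable_fun => x; exact: continuous_sin.
  exact: mulrl_measurable.
rewrite (_ : rademacher n = fun x : R =>
    if sin (2 ^+ n.-1 * pi * x) == 0 then 0 else
    if sin (2 ^+ n.-1 * pi * x) < 0 then -1 else 1); last first.
  by apply/funext => x.
apply: measurable_fun_ifT => //; first exact: measurable_fun_eqr.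
apply: measurable_fun_ifT => //; exact: measurable_fun_ltr.
Qed.

Lemma integral_itvoo_split (f : R -> \bar R) u v w : u < v < w ->
  measurable_fun setT f -> (forall x, 0 <= f x)%E ->
  (\int[mu]_(x in `]u, w[) f x =
   \int[mu]_(x in `]u, v[) f x + \int[mu]_(x in `]v, w[) f x)%E.
Proof.
move=> /andP[uv vw] mf f0.
have m A : measurable_fun A f by exact: measurable_funTS.
have -> : `]u, w[%classic = `]u, v] `|` `]v, w[ :> set R.
  by rewrite -itv_bndbnd_setU// bnd_simp ltW.
rewrite ge0_integral_setU//; first by rewrite (@integral_itv_bndoo _ u v).
  exact: m.
apply/disj_setPS => x [] /=; rewrite !in_itv/= => /andP[_ xv] /andP[vx _].
by move: (lt_le_trans vx xv); rewrite ltxx.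
Qed.

(** On a dyadic interval of length 2^-j the functions r_1, ..., r_(j+1) are constant, their
    contribution being stored in [x]. Halving the interval frees r_(j+2), which is 1 on the left
    half and -1 on the right: one step of the recursion of [radE]. *)
Lemma integral_rademacher_itv a F (n j k : nat) x :
  measurable_fun setT F -> (forall y, 0 <= F y) ->
  (\int[mu]_(y in `](k%:R / 2 ^+ j)%R, (k.+1%:R / 2 ^+ j)%R[)
     (F (x + \sum_(i <- iota j.+2 n) a i * rademacher i y)%R)%:E =
   (radE (iota j.+2 n) a F x / 2 ^+ j)%:E)%E.
Proof.
move=> mF F0.
have p0 m : 0 < 2 ^+ m :> R by rewrite exprn_gt0.
elim: n j k x => [|n IH] j k x /=.
  under eq_integral do rewrite big_nil addr0.
  rewrite integral_cst//= lebesgue_measure_itv/= lte_fin ltr_pM2r ?invr_gt0//.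
  rewrite ltr_nat ltnSn -EFinD -EFinM; congr EFin.
  by rewrite -natr1; field; rewrite gt_eqF.
have step (i : nat) :
    (\int[mu]_(y in `](i%:R / 2 ^+ j.+1)%R, (i.+1%:R / 2 ^+ j.+1)%R[)
      (F (x + \sum_(i <- j.+2 :: iota j.+3 n) a i * rademacher i y)%R)%:E =
    (radE (iota j.+3 n) a F (x + a j.+2 * (-1) ^+ i) / 2 ^+ j.+1)%:E)%E.
  rewrite -(IH _ i); apply: eq_integral => y; rewrite inE/= in_itv/= => /rademacher_itv h.
  by rewrite big_cons h addrA.
have -> : k%:R / 2 ^+ j = k.*2%:R / 2 ^+ j.+1 :> R.
  by rewrite -muln2 natrM exprS; field; rewrite gt_eqF.
have -> : k.+1%:R / 2 ^+ j = k.*2.+2%:R / 2 ^+ j.+1 :> R.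
  by rewrite -doubleS -muln2 natrM exprS; field; rewrite gt_eqF.
rewrite (@integral_itvoo_split _ _ (k.*2.+1%:R / 2 ^+ j.+1)); last 3 first.
- by rewrite !ltr_pM2r ?invr_gt0// !ltr_nat !ltnSn.
- apply/measurable_EFinP; apply: measurableT_comp => //.
  apply: measurable_funD => //; apply: measurable_sum => i.
  by apply: measurable_funM => //; exact: measurable_rademacher.
- by move=> y; rewrite lee_fin.
rewrite !step -(signr_odd _ k.*2.+1) -(signr_odd _ k.*2) oddS odd_double.
rewrite -EFinD expr0 expr1 mulr1 mulrN1 exprS; congr EFin.
by field; rewrite gt_eqF.
Qed.

(* With this indexing r_1 = 1 on ]0, 1[, so only even functions of the sum have
   the same law as for independent signs. *)
Lemma integral_rademacher a F (m : nat) :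
  measurable_fun setT F -> (forall y, 0 <= F y) -> (forall y, F (- y) = F y) ->
  (\int[leb01]_y (F (psum a rademacher m y))%:E = (radE (iota 1 m) a F 0)%:E)%E.
Proof.
move=> mF F0 evF.
have mG : measurable_fun setT (fun y : R => (F (psum a rademacher m y))%:E).
  apply/measurable_EFinP; apply: measurableT_comp => //.
  apply: measurable_sum => i.
  by apply: measurable_funM => //; exact: measurable_rademacher.
rewrite /leb01 integral_uniform//; last by move=> y; rewrite lee_fin.
rewrite subr0 invr1 mul1e integral_itv_bndoo; last exact: measurable_funTS.
case: m mG => [|m] mG.
  under eq_integral do rewrite /psum big_geq//.
  rewrite integral_cst//= lebesgue_measure_itv/= lte_fin ltr01 oppr0 adde0 mule1.
  by [].
transitivity (radE (iota 2 m) a F (a 1%N))%:E.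
  have := @integral_rademacher_itv a F m 0 0 (a 1%N) mF F0.
  rewrite expr0 !divr1 => <-; apply: eq_integral => y.
  rewrite inE/= in_itv/= => y01.
  rewrite /psum /index_iota subSS subn0 big_cons (@rademacher_itv 0 0) ?mulr1//.
  by rewrite expr0 !divr1.
(* The two branches of the first sign agree by evenness, so freezing it at 1 does not change the
   mean. *)
by congr EFin; rewrite /= sub0r radE_even// add0r; lra.
Qed.

Lemma tnorm_rademacher a (m : nat) t : 0 < t ->
  tnorm leb01 t (psum a rademacher m) = (radN t (iota 1 m) a)%:E.
Proof.
move=> t0; rewrite tnormE.
rewrite (@integral_rademacher a (fun y => `|y| `^ t)) ?poweR_EFin//.
- by apply: (measurableT_comp (measurable_powR _)) => //; exact: measurable_normr.
- by move=> y; rewrite normrN.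
Qed.

End RademacherLaw.

(** * Tails from moments *)

Section TailsFromMoments.
Context {R : realType}.
Local Open Scope ereal_scope.

Lemma markov_moment d (T : measurableType d) (P : probability T R) (X : T -> R)
    (n : nat) (z : R) : measurable_fun setT X -> (0 < z)%R ->
  (z ^+ n)%:E * P [set x | (z < `|X x|)%R] <= \int[P]_x (`|X x| ^+ n)%:E.
Proof.
move=> mX z0; set A := [set x | _].
have mA : measurable A by apply: measurable_gt; exact: measurableT_comp.
have mI : measurable_fun setT (fun x => (\1_A x)%:E : \bar R).
  by apply/measurable_EFinP; exact: measurable_indic.
have -> : P A = \int[P]_x (\1_A x)%:E by rewrite integral_indic ?setIT.
rewrite -ge0_integralZl//=; last by rewrite lee_fin exprn_ge0 ?ltW.
apply: ge0_le_integral => //=.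
- by move=> x _; rewrite -EFinM lee_fin mulr_ge0 ?exprn_ge0 ?(ltW z0).
- exact: measurable_funeM.
- by apply/measurable_EFinP; apply: measurable_funX; exact: measurableT_comp.
move=> x _; rewrite -EFinM lee_fin indicE.
have [/set_mem zX|_] := boolP (x \in A); last by rewrite mulr0 exprn_ge0.
by rewrite mulr1 lerXn2r ?nnegrE ?(ltW z0)//; move: zX; rewrite /A/= => /ltW.
Qed.

(** With u = |X|^n, m = M^n, q = D^(2n) and k = 1 / (4 q m), the pointwise bound u <= m/2 + k u^2 +
    q m 1_A replaces Cauchy-Schwarz: on A complete the square, off A use u <= (M/2)^n <= m/2.
    Integrating gives m <= m/2 + m/4 + q m P(A). *)
Lemma paley_zygmund d (T : measurableType d) (P : probability T R) (X : T -> R)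
    (n : nat) (M D : R) : measurable_fun setT X -> (0 < n)%N -> (0 < M)%R -> (0 < D)%R ->
  \int[P]_x (`|X x| ^+ n)%:E = (M ^+ n)%:E ->
  \int[P]_x (`|X x| ^+ n.*2)%:E <= ((D * M) ^+ n.*2)%:E ->
  ((4 * D ^+ n.*2)^-1)%:E <= P [set x | (M / 2 < `|X x|)%R].
Proof.
move=> mX n0 M0 D0 I1 I2; set A := [set x | _].
have mN : measurable_fun setT (fun x => `|X x|)%R by exact: measurableT_comp.
have mA : measurable A by exact: measurable_gt.
pose m := (M ^+ n)%R; pose q := (D ^+ n.*2)%R.
have m0 : (0 < m)%R by rewrite exprn_gt0.
have q0 : (0 < q)%R by rewrite exprn_gt0.
pose k := (4 * q * m)^-1%R; have k0 : (0 < k)%R by rewrite invr_gt0 !mulr_gt0.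
pose h x := (m / 2 + (k * `|X x| ^+ n.*2 + q * m * \1_A x))%R.
have pt x : (`|X x| ^+ n <= h x)%R.
  rewrite /h indicE; set u := (`|X x| ^+ n)%R.
  have -> : (`|X x| ^+ n.*2 = u ^+ 2)%R by rewrite -exprM muln2.
  have u0 : (0 <= u)%R by rewrite exprn_ge0.
  have [_|/negP nA] := boolP (x \in A).
    rewrite mulr1 -subr_ge0.
    have -> : (m / 2 + (k * u ^+ 2 + q * m) - u = k * (u - 2 * q * m) ^+ 2 + m / 2)%R.
      by rewrite /k; field; rewrite !gt_eqF.
    by rewrite addr_ge0 ?divr_ge0 ?(ltW m0)//; apply: mulr_ge0; [exact: ltW|exact: sqr_ge0].
  rewrite mulr0 addr0 -[leLHS]addr0 lerD//; last first.
    by apply: mulr_ge0; [exact: ltW|exact: sqr_ge0].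
  have XM : (`|X x| <= M / 2)%R.
    by rewrite leNgt; apply/negP => XM; apply: nA; exact: mem_set.
  apply: le_trans (_ : ((M / 2) ^+ n <= _)%R).
    by rewrite ler_pXn2r ?nnegrE ?divr_ge0 ?(ltW M0).
  rewrite exprMn ler_pM2l// exprVn lef_pV2 ?posrE ?exprn_gt0//.
  by rewrite -[leLHS]expr1 ler_weXn2l// ler1n.
have mXn j : measurable_fun setT (fun x => (`|X x| ^+ j)%:E).
  by apply/measurable_EFinP; exact: measurable_funX.
have mI : measurable_fun setT (fun x => (\1_A x)%:E : \bar R).
  by apply/measurable_EFinP; exact: measurable_indic.
have Ih : \int[P]_x (h x)%:E =
    (m / 2)%:E + (k%:E * \int[P]_x (`|X x| ^+ n.*2)%:E + (q * m)%:E * P A).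
  have -> : P A = \int[P]_x (\1_A x)%:E by rewrite integral_indic ?setIT.
  have e1 x : 0 <= k%:E * (`|X x| ^+ n.*2)%:E.
    by rewrite -EFinM lee_fin; apply: mulr_ge0; [exact: ltW|exact: exprn_ge0].
  have e2 x : 0 <= (q * m)%:E * (\1_A x)%:E.
    by rewrite -EFinM lee_fin !mulr_ge0// ltW.
  have -> : k%:E * \int[P]_x (`|X x| ^+ n.*2)%:E =
      \int[P]_x (k%:E * (`|X x| ^+ n.*2)%:E).
    rewrite ge0_integralZl//; last by rewrite lee_fin ltW.
  have -> : (q * m)%:E * \int[P]_x (\1_A x)%:E =
      \int[P]_x ((q * m)%:E * (\1_A x)%:E).
    rewrite ge0_integralZl//; last by rewrite lee_fin mulr_ge0 ?(ltW q0) ?(ltW m0).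
  have m1 : measurable_fun setT (fun x => k%:E * (`|X x| ^+ n.*2)%:E).
    exact: measurable_funeM.
  have m2 : measurable_fun setT (fun x => (q * m)%:E * (\1_A x)%:E).
    exact: measurable_funeM.
  rewrite -ge0_integralD//.
  rewrite -[X in X + _]mule1 -(@probability_setT _ _ _ P) -integral_cst//.
  rewrite -ge0_integralD//.
  - by move=> x _; rewrite lee_fin divr_ge0 ?(ltW m0).
  - by move=> x _; rewrite adde_ge0.
  - exact: emeasurable_funD.
have : m%:E <= (m / 2)%:E + (k%:E * ((D * M) ^+ n.*2)%:E + (q * m)%:E * P A).
  rewrite -I1; apply: le_trans (_ : \int[P]_x (h x)%:E <= _).
    apply: ge0_le_integral => //=.
      by apply/measurable_EFinP; apply: measurable_funD => //; apply: measurable_funD;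
        apply: measurable_funM => //; exact: measurable_funX.
    by move=> x _; rewrite lee_fin.
  by rewrite Ih leeD2l// leeD2r// lee_pmul2l.
have -> : ((D * M) ^+ n.*2 = q * m ^+ 2)%R by rewrite exprMn /q /m -exprM muln2.
have PA : P A \is a fin_num by exact: fin_num_measure.
rewrite -(fineK PA) -!EFinM -!EFinD !lee_fin -/q.
set p := fine _ => H.
have kE : (k * (q * m ^+ 2) = m / 4)%R by rewrite /k; field; rewrite !gt_eqF.
rewrite kE in H.
have : (m * 4^-1 <= m * (q * p))%R by lra.
by rewrite ler_pM2l// invfM => h4; rewrite ler_pdivrMr// mulrC.
Qed.

Lemma tnorm_moment d (T : measurableType d) (P : probability T R) (X : T -> R)
    (n : nat) (M : R) : (0 < n)%N -> tnorm P n%:R X = M%:E ->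
  \int[P]_x (`|X x| ^+ n)%:E = (M ^+ n)%:E.
Proof.
move=> n0 tX.
have M0 : (0 <= M)%R by rewrite -lee_fin -tX tnorm_ge0.
have nn0 : n%:R != 0%R :> R by rewrite pnatr_eq0 -lt0n.
rewrite -powR_mulrn// -poweR_EFin -tX tnormE -poweRrM mulVf// poweRe1.
  by apply: eq_integral => x _; rewrite powR_mulrn.
by apply: integral_ge0.
Qed.

(* With [M n] the moments of [Y], let [n] be the first integer with [M n > 2 z]:
   Paley-Zygmund at [n] bounds the tail of [Y] at [z] from below, and Markov at
   [n - 1], where [M (n - 1) <= 2 z], bounds the tail of [X] from above. If there
   is no such [n], Markov at every order shows that the tail of [X] vanishes. *)
Lemma tail_le_of_moments d d' (T : measurableType d) (T' : measurableType d')
    (P : probability T R) (P' : probability T' R) (X : T -> R) (Y : T' -> R)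
    (L D : R) (N M : nat -> R) : measurable_fun setT X -> measurable_fun setT Y ->
  (1 <= L)%R -> (1 <= D)%R ->
  (forall n, (0 < n)%N -> tnorm P n%:R X = (N n)%:E) ->
  (forall n, (0 < n)%N -> tnorm P' n%:R Y = (M n)%:E) ->
  (forall n, (0 < n)%N -> N n <= L * M n)%R ->
  (forall n, (0 < n)%N -> M n.*2 <= D * M n)%R ->
  forall C z : R, C = (4 * L * D ^+ 4)%R -> (0 < z)%R ->
  P [set x | (C * z < `|X x|)%R] <= C%:E * P' [set y | (z < `|Y y|)%R].
Proof.
move=> mX mY L1 D1 NE ME NM MD C z CE z0.
have D0 : (0 < D)%R by lra.
have D4 : (1 <= D ^+ 4)%R by rewrite exprn_ege1.
have C4 : (4 <= C)%R by rewrite CE; nra.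
have C0 : (0 < C)%R by lra.
have Cz0 : (0 < C * z)%R by rewrite mulr_gt0.
have M0 n : (0 < n)%N -> (0 <= M n)%R.
  by move=> n0; rewrite -lee_fin -ME// tnorm_ge0.
set A := [set x | _]; set B := [set y | _].
have mA : measurable A by apply: measurable_gt; exact: measurableT_comp.
have mB : measurable B by apply: measurable_gt; exact: measurableT_comp.
have PA : P A \is a fin_num by exact: fin_num_measure.
have PB : P' B \is a fin_num by exact: fin_num_measure.
rewrite -(fineK PA) -(fineK PB) -EFinM lee_fin.
set p := fine _; set q := fine _.
have p0 : (0 <= p)%R by rewrite fine_ge0.
have q0 : (0 <= q)%R by rewrite fine_ge0.
have markov n : (0 < n)%N -> (M n <= 2 * z)%R -> (p <= (2 * D ^+ 4)^-1 ^+ n)%R.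
  move=> n0 Mz; have := @markov_moment _ _ P X n _ mX Cz0.
  rewrite -/A -(fineK PA) (tnorm_moment _ _ _ _ _ _ n0 (NE n n0)) -EFinM lee_fin -/p => h.
  have : ((C * z) ^+ n * p <= (L * (2 * z)) ^+ n)%R.
    apply: (le_trans h); rewrite ler_pXn2r// ?nnegrE.
    - by apply: le_trans (NM n n0) _; rewrite ler_pM2l//; lra.
    - by rewrite -lee_fin -NE// tnorm_ge0.
    - by rewrite !mulr_ge0// ?(ltW z0)//; lra.
  (* The choice C = 4 L D^4 makes the ratio in Markov's inequality equal to 1 / (2 D^4). *)
  have -> : (L * (2 * z) = (C * z) * (2 * D ^+ 4)^-1)%R.
    by rewrite CE; field; rewrite gt_eqF.
  by rewrite [((C * z / _) ^+ n)%R]exprMn ler_pM2l// exprn_gt0.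
have [[n Mn]|noM] := pselect (exists n, (0 < n)%N && (2 * z < M n)%R); last first.
  have p_le n : (0 < n)%N -> (p <= (2 * D ^+ 4)^-1 ^+ n)%R.
    move=> n0; apply: markov => //; rewrite leNgt; apply/negP => zM.
    by apply: noM; exists n; rewrite n0.
  suff -> : p = 0%R by rewrite mulr_ge0// ltW.
  apply/eqP; rewrite eq_le p0 andbT leNgt; apply/negP => pgt0.
  have := @cvg_geometric R 1 2^-1.
  rewrite ger0_norm// invf_lt1// ltr1n => /(_ isT) /cvgrPdist_lt /(_ p pgt0).
  case=> k _ /(_ k.+1 (leqnSn k)); rewrite /geometric/= mul1r sub0r normrN ger0_norm//.
  rewrite ltNge => /negP; apply; apply: le_trans (p_le k.+1 isT) _.
  rewrite ler_pXn2r ?nnegrE ?invr_ge0//; last by lra.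
  by rewrite lef_pV2 ?posrE//; lra.
have ex : exists n, (0 < n)%N && (2 * z < M n)%R by exists n.
case: (ex_minnP ex) => {Mn ex} {}n /andP[n0 Mn] n_min.
have Mn0 : (0 < M n)%R by apply: lt_trans Mn; rewrite mulr_gt0.
have qn : ((4 * D ^+ n.*2)^-1 <= q)%R.
  rewrite -lee_fin fineK//.
  apply: le_trans (@paley_zygmund _ _ P' Y n (M n) D mY n0 Mn0 D0 _ _) _.
  - exact: tnorm_moment (ME n n0).
  - rewrite (tnorm_moment _ _ _ _ _ (M n.*2)) ?double_gt0// ?ME ?double_gt0//.
    by rewrite lee_fin ler_pXn2r ?nnegrE ?M0 ?double_gt0 ?MD// mulr_ge0 ?M0 ?(ltW D0).
  - apply: le_measure; rewrite ?inE.
    + by apply: measurable_gt; exact: measurableT_comp.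
    + by apply: measurable_gt; exact: measurableT_comp.
    + by move=> y /=; apply: le_lt_trans; rewrite ler_pdivlMr// mulrC ltW.
apply: le_trans (_ : (C * (4 * D ^+ n.*2)^-1 <= _)%R); last by rewrite ler_pM2l.
have Dn0 : (0 < D ^+ n.*2)%R by rewrite exprn_gt0.
case: n => // -[|n] in n0 Mn n_min Mn0 qn Dn0 *.
  (* For n = 1 there is no previous order; the trivial bound on p suffices because C >= 4 D^2. *)
  have p1 : (p <= 1)%R by rewrite -lee_fin fineK// probability_le1// .
  apply: le_trans p1 _; rewrite ler_pdivlMr; last by rewrite mulr_gt0.
  rewrite mul1r CE (_ : D ^+ 4 = D ^+ 2 * D ^+ 2)%R -?exprD//.
  have D2 : (1 <= D ^+ 2)%R by rewrite exprn_ege1.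
  have : (1 <= L * D ^+ 2)%R by rewrite -[leLHS]mul1r ler_pM//.
  by rewrite /=; nra.
have Mz : (M n.+1 <= 2 * z)%R.
  by rewrite leNgt; apply/negP => zM; have := n_min n.+1; rewrite zM ltnn => /(_ isT).
(* The minimal order is now n + 2, and D^(4(n+1)) dominates D^(2(n+2)) since 2(n+2) <= 4(n+1); C >=
   4 absorbs the remaining 4. *)
apply: le_trans (markov n.+1 isT Mz) _.
apply: le_trans (_ : ((D ^+ n.+2.*2)^-1 <= _)%R); last first.
  move: (D ^+ n.+2.*2)%R Dn0 => w w0.
  by rewrite invfM mulrA ler_peMl ?invr_ge0 ?(ltW w0)// ler_pdivlMr// mul1r.
rewrite exprVn lef_pV2 ?posrE ?exprn_gt0//; last by rewrite mulr_gt0// exprn_gt0.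
rewrite exprMn -exprM; apply: le_trans (_ : (D ^+ (4 * n.+1) <= _)%R).
  rewrite ler_weXn2l// -mul2n (_ : 4 = 2 * 2)%N// -mulnA leq_mul2l/=.
  by rewrite mul2n -addnn addSn addnS !ltnS leq_addr.
by rewrite ler_peMl ?exprn_ge0 ?(ltW D0)// exprn_ege1// ler1n.
Qed.

End TailsFromMoments.

(** * The K-functional of finitely supported sequences *)

Section KFunctional.
Context {R : realType}.
Implicit Types (a b c u : nat -> R) (m : nat) (s t x : R).

Lemma nneseries_ge_iota u m : (forall n, 0 <= u n) ->
  (((\sum_(n <- iota 1 m) u n)%:E <= \sum_(0 <= n <oo) (u n)%:E))%E.
Proof.
move=> u0; apply: (@le_trans _ _ (\sum_(0 <= n < m.+1) (u n)%:E)%E).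
  rewrite big_ltn// sumEFin /index_iota subn1/= lee_fin.
  by rewrite lerDr.
by apply: nneseries_lim_ge => n _ _; rewrite lee_fin.
Qed.

Lemma nneseries_eq_iota u m : (forall n, 0 <= u n) -> u 0%N = 0 ->
  (forall n, (m < n)%N -> u n = 0) ->
  (\sum_(0 <= n <oo) (u n)%:E = (\sum_(n <- iota 1 m) u n)%:E)%E.
Proof.
move=> u0 u00 um; rewrite (@nneseries_split _ _ 0 m.+1); last first.
  by move=> n _; rewrite lee_fin.
rewrite eseries0 ?adde0; last by move=> n mn _; rewrite add0n in mn; rewrite um.
by rewrite add0n big_ltn// u00 add0e sumEFin /index_iota subn1.
Qed.

(** Cutting b and c off outside {1, ..., m} still decomposes a and turns both series into finite
    sums. *)
Lemma K12_le a b c m s : 0 <= s -> a 0%N = 0 -> (forall n, (m < n)%N -> a n = 0) ->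
  (forall n, a n = b n + c n) ->
  (K12 s a <= (\sum_(n <- iota 1 m) `|b n| +
    s * Num.sqrt (\sum_(n <- iota 1 m) c n ^+ 2))%:E)%E.
Proof.
move=> s0 a0 am abc.
pose tr u n := if (0 < n <= m)%N then u n else 0 : R.
have trE u n : n \in iota 1 m -> tr u n = u n.
  by rewrite mem_iota add1n ltnS /tr => ->.
have tr0 u : tr u 0%N = 0 by [].
have trm u n : (m < n)%N -> tr u n = 0 by move=> mn; rewrite /tr [(n <= m)%N]leqNgt mn andbF.
have l1E : l1norm (tr b) = (\sum_(n <- iota 1 m) `|b n|)%:E.
  rewrite /l1norm (@nneseries_eq_iota (fun n => `|tr b n|) m) ?tr0 ?normr0//.
    by congr EFin; rewrite !big_seq; apply: eq_bigr => n /trE ->.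
  by move=> n mn; rewrite trm ?normr0.
have l2E : l2sq (tr c) = (\sum_(n <- iota 1 m) c n ^+ 2)%:E.
  rewrite /l2sq (@nneseries_eq_iota (fun n => tr c n ^+ 2) m) ?tr0 ?expr0n//.
  - by congr EFin; rewrite !big_seq; apply: eq_bigr => n /trE ->.
  - by move=> n; exact: sqr_ge0.
  - by move=> n mn; rewrite trm ?expr0n.
apply: ereal_inf_lbound; exists (tr b), (tr c).
rewrite l1E l2E !ltry; split=> //.
move=> n; rewrite /tr; case: ifPn => // nm; rewrite addr0.
by case: n nm => // n; rewrite ltn0Sn/= -ltnNge => /am.
Qed.

(** Dropping the terms outside {1, ..., m} only lowers the two norms of a competitor in the
    infimum. *)
Lemma K12_ge a m s x : 0 <= s ->
  (forall b c, (forall n, a n = b n + c n) ->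
    x <= \sum_(n <- iota 1 m) `|b n| + s * Num.sqrt (\sum_(n <- iota 1 m) c n ^+ 2)) ->
  (x%:E <= K12 s a)%E.
Proof.
move=> s0 h; apply: le_ereal_inf_tmp => _ [b [c [abc [bf [cf ->]]]]].
rewrite lee_fin; apply: le_trans (h b c abc) _.
have le_fine u : (forall n, 0 <= u n) -> (\sum_(0 <= n <oo) (u n)%:E < +oo)%E ->
    \sum_(n <- iota 1 m) u n <= fine (\sum_(0 <= n <oo) (u n)%:E)%E.
  move=> u0 uf; rewrite -lee_fin fineK ?nneseries_ge_iota// ge0_fin_numE//.
  by apply: nneseries_ge0 => n _ _; rewrite lee_fin.
apply: lerD; first by apply: le_fine.
rewrite ler_wpM2l// ler_wsqrtr//.
by apply: le_fine => // n; exact: sqr_ge0.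
Qed.

Definition radA : R := 2 * expR 2.

Lemma radA_ge1 : 1 <= radA.
Proof. by rewrite /radA; have := @expR_ge1Dx R 2; lra. Qed.

Lemma K12_radN a m t : 1 <= t -> a 0%N = 0 -> (forall n, (m < n)%N -> a n = 0) ->
  exists k : R, [/\ K12 (Num.sqrt t) a = k%:E,
    radN t (iota 1 m) a <= radA * k & k <= 9 * radN t (iota 1 m) a].
Proof.
move=> t1 a0 am; have A0 : 0 < radA := lt_le_trans ltr01 radA_ge1.
have Kge : ((radN t (iota 1 m) a / radA)%:E <= K12 (Num.sqrt t) a)%E.
  apply: (@K12_ge _ m); first exact: sqrtr_ge0.
  by move=> b c abc; rewrite ler_pdivrMr// mulrC; exact: radN_le.
have [b [c [abc bc]]] := radN_ge (iota 1 m) a t t1.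
have Kle : (K12 (Num.sqrt t) a <= (9 * radN t (iota 1 m) a)%:E)%E.
  by apply: le_trans (@K12_le a b c m _ (sqrtr_ge0 _) a0 am abc) _; rewrite lee_fin.
have Kfin : K12 (Num.sqrt t) a \is a fin_num.
  rewrite fin_numElt (lt_le_trans _ Kge) ?ltNyr// (le_lt_trans Kle) ?ltry//.
exists (fine (K12 (Num.sqrt t) a)); rewrite fineK//; split=> //.
- by rewrite -ler_pdivrMl// mulrC -lee_fin fineK.
- by rewrite -lee_fin fineK.
Qed.

(** The decomposition of [radN_ge] at n is reused at 2n, where the l_2 weight grows by sqrt 2 <= 2;
    hence the constant 9 * 2 * [radA]. *)
Lemma radN_double l a (n : nat) : (0 < n)%N ->
  radN n.*2%:R l a <= 18 * radA * radN n%:R l a.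
Proof.
move=> n0; have n1 : 1 <= n%:R :> R by rewrite ler1n.
have n21 : 1 <= n.*2%:R :> R by rewrite ler1n double_gt0.
have [b [c [abc bc]]] := radN_ge l a n%:R n1.
apply: le_trans (radN_le l a b c n.*2%:R n21 abc) _.
rewrite -/radA -mulrA mulrCA ler_pM2l; last exact: lt_le_trans radA_ge1.
rewrite -muln2 natrM mulrC sqrtrM//.
have B0 : 0 <= \sum_(i <- l) `|b i| by apply: sumr_ge0.
have s2 : Num.sqrt 2 <= 2 :> R.
  by rewrite -[leRHS]ger0_norm// -sqrtr_sqr ler_sqrt ?exprn_ge0//; lra.
have c0 := sqrtr_ge0 (\sum_(i <- l) c i ^+ 2).
have n0' := sqrtr_ge0 (n%:R : R).
have := mulr_ge0 n0' c0.
nra.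
Qed.

End KFunctional.

(** * The equivalences *)

Section Equivalence.
Context {R : realType} {d : measure_display} {T : measurableType d}
  (P : probability T R) (f : nat -> T -> R) (mf : forall n, measurable_fun setT (f n)).
Implicit Types (bound : option nat) (C : R).

Lemma measurable_psum d' (T' : measurableType d') (g : nat -> T' -> R) a (m : nat) :
  (forall n, measurable_fun setT (g n)) -> measurable_fun setT (psum a g m).
Proof.
by move=> mg; apply: measurable_sum => i; exact: measurable_funM.
Qed.

Lemma Lt_equiv_radN bound C : Lt_equiv_const P f bound C ->
  forall t (m : nat) a, 1 <= t -> admissible bound m ->
  exists y : R, [/\ tnorm P t (psum a f m) = y%:E,
    radN t (iota 1 m) a <= Num.max 1 C * y &
    y <= Num.max 1 C * radN t (iota 1 m) a].
Proof.
move=> [C0 H] t m a t1 bm; have [] := H t m a t1 bm.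
rewrite tnorm_rademacher ?(lt_le_trans _ t1)// -!EFinM.
set r := radN _ _ _; have r0 : 0 <= r by exact: radN_ge0.
have := tnorm_ge0 _ _ P t (psum a f m).
case: tnorm => [y||]; rewrite ?leye_eq// !lee_fin => y0 h1 h2.
have C1 : C <= Num.max 1 C by rewrite le_max lexx orbT.
exists y; split=> //.
  by rewrite ler_pdivrMl// in h1; apply: le_trans h1 _; rewrite ler_wpM2r.
by apply: le_trans h2 _; rewrite ler_wpM2r.
Qed.

Lemma Lt_equiv_of_dist bound C :
  dist_equiv_const P f leb01 rademacher bound C ->
  Lt_equiv_const P f bound (Num.max 1 C * C).
Proof.
move=> [C0 H]; have C1 : 0 < Num.max 1 C by rewrite lt_max ltr01.
split=> [|t m a t1 bm]; first by rewrite mulr_gt0.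
have mp := @measurable_psum _ _ f a m mf.
have mr := @measurable_psum _ _ rademacher a m measurable_rademacher.
split.
  rewrite lee_pdivrMl ?mulr_gt0//.
  apply: tnorm_le_tail => // z z0.
  by have [] := H m a z bm z0.
apply: tnorm_le_tail => // z z0.
(* The left tail inequality is used at z / C, which moves the dilation to the Rademacher side. *)
have z'0 : 0 < C^-1 * z by rewrite mulr_gt0// invr_gt0.
have [+ _] := H m a _ bm z'0.
by rewrite lee_pdivrMl// mulrA divff ?gt_eqF// mul1r.
Qed.

Lemma K_equiv_of_Lt bound C : Lt_equiv_const P f bound C ->
  K_equiv_const P f bound (Num.max 1 C * (9 * radA)).
Proof.
move=> HL; have C1 : 1 <= Num.max 1 C by rewrite le_max lexx.
have A1 := @radA_ge1 R.
have g1 : 1 <= Num.max 1 C * (9 * radA) by nra.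
split=> // t m a t1 bm a0 am.
have [y [-> ry yr]] := Lt_equiv_radN _ _ HL t m a t1 bm.
have [k [-> rk kr]] := K12_radN a m t t1 a0 am.
have r0 := radN_ge0 t (iota 1 m) a.
have k0 : 0 <= k by nra.
rewrite -!EFinM !lee_fin ler_pdivrMl ?(lt_le_trans ltr01)//.
have y0 : 0 <= y by nra.
move: (Num.max 1 C) C1 ry yr {g1} => D D1 ry yr.
split.
  apply: (le_trans kr); apply: le_trans (_ : 9 * (D * y) <= _); first by rewrite ler_pM2l.
  have := mulr_ge0 (le_trans ler01 D1) y0; nra.
apply: (le_trans yr).
apply: le_trans (_ : D * (radA * k) <= _); first by rewrite ler_pM2l// (lt_le_trans ltr01).
have := mulr_ge0 (le_trans ler01 D1) (mulr_ge0 (le_trans ler01 A1) k0); nra.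
Qed.

Lemma Lt_equiv_of_K bound (beta : R) : K_equiv_const P f bound beta ->
  Lt_equiv_const P f bound (beta * (9 * radA)).
Proof.
move=> [b1 H]; have A1 := @radA_ge1 R.
have b0 : 0 < beta by lra.
have g0 : 0 < beta * (9 * radA) by rewrite !mulr_gt0//; lra.
split=> // t m a t1 bm.
(* The K-functional condition speaks only of sequences supported in {1, ..., m}, while here [a] is
   arbitrary; the sums [psum] do not see the difference. *)
pose a' n := if (0 < n <= m)%N then a n else 0.
have aE n : n \in iota 1 m -> a' n = a n.
  by rewrite mem_iota add1n ltnS /a' => ->.
have pE d' (T' : measurableType d') (g : nat -> T' -> R) : psum a g m = psum a' g m.
  apply/funext => x; rewrite /psum /index_iota subn1/= !big_seq.
  by apply: eq_bigr => n /aE ->.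
have a'0 : a' 0%N = 0 by [].
have a'm n : (m < n)%N -> a' n = 0.
  by move=> mn; rewrite /a' [(n <= m)%N]leqNgt mn andbF.
have [] := H t m a' t1 bm a'0 a'm.
rewrite !pE tnorm_rademacher ?(lt_le_trans _ t1)//.
have [k [-> rk kr]] := K12_radN a' m t t1 a'0 a'm.
have r0 := radN_ge0 t (iota 1 m) a'.
set r := radN _ _ _ in rk kr r0 *.
have k0 : 0 <= k by nra.
case: tnorm => [y||]; rewrite -?EFinM ?leye_eq ?leeNy_eq// !lee_fin.
rewrite !ler_pdivrMl// => ky yk.
have y0 : 0 <= y by rewrite -(pmulr_rge0 _ b0) (le_trans k0).
split.
  apply: (le_trans rk); apply: le_trans (_ : radA * (beta * y) <= _).
    by rewrite ler_pM2l// (lt_le_trans ltr01).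
  have := mulr_ge0 (le_trans ler01 A1) (mulr_ge0 (ltW b0) y0); nra.
apply: (le_trans yk); apply: le_trans (_ : beta * (9 * r) <= _); first by rewrite ler_pM2l.
have := mulr_ge0 (ltW b0) r0; nra.
Qed.

(** This is 4 L D^4 from [tail_le_of_moments], with L = max(1, C). The factor L^2 in D arises from
    carrying the Rademacher doubling constant 18 * [radA] over to the moments of the other system
    and back. *)
Definition dist_const C : R :=
  4 * Num.max 1 C * (Num.max 1 C ^+ 2 * (18 * radA)) ^+ 4.

Lemma dist_equiv_of_Lt bound C : Lt_equiv_const P f bound C ->
  dist_equiv_const P f leb01 rademacher bound (dist_const C).
Proof.
move=> HL; have C1 : 1 <= Num.max 1 C by rewrite le_max lexx.
have A1 := @radA_ge1 R.
set L := Num.max 1 C in C1 *.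
pose D := L ^+ 2 * (18 * radA).
have L21 : 1 <= L ^+ 2 by rewrite exprn_ege1.
have D1 : 1 <= D by rewrite /D; nra.
have D0 : 0 < D by lra.
have K0 : 0 < dist_const C.
  by rewrite /dist_const -/L -/D !mulr_gt0 ?exprn_gt0//; lra.
split=> // m a z bm z0.
have mp := @measurable_psum _ _ f a m mf.
have mr := @measurable_psum _ _ rademacher a m measurable_rademacher.
pose M n := radN n%:R (iota 1 m) a.
pose N n := fine (tnorm P n%:R (psum a f m)).
have ge1 n : (0 < n)%N -> 1 <= n%:R :> R by rewrite ler1n.
have ME n : (0 < n)%N -> tnorm leb01 n%:R (psum a rademacher m) = (M n)%:E.
  by move=> n0; rewrite tnorm_rademacher// ltr0n.
have NP n : (0 < n)%N ->
    [/\ tnorm P n%:R (psum a f m) = (N n)%:E, M n <= L * N n & N n <= L * M n].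
  move=> /ge1 n1; have [y [yE h1 h2]] := Lt_equiv_radN _ _ HL n%:R m a n1 bm.
  by rewrite /N yE.
have M0 n : 0 <= M n by exact: radN_ge0.
have MD n : (0 < n)%N -> M n.*2 <= 18 * radA * M n by exact: radN_double.
have MD' n : (0 < n)%N -> M n.*2 <= D * M n.
  move=> n0; apply: (le_trans (MD n n0)); rewrite ler_wpM2r// /D; nra.
have ND n : (0 < n)%N -> N n.*2 <= D * N n.
  move=> n0; have [_ _ h1] := NP n.*2 (etrans (double_gt0 n) n0).
  have [_ h2 _] := NP n n0; apply: (le_trans h1).
  have -> : D * N n = L * (18 * radA * (L * N n)) by rewrite /D; ring.
  rewrite ler_pM2l ?(lt_le_trans ltr01)//; apply: le_trans (MD n n0) _.
  by rewrite ler_pM2l// mulr_gt0// (lt_le_trans ltr01).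
(* The tail comparison is used twice with the roles of the two systems exchanged, which is why [D]
   must serve as doubling constant for both. *)
have fin_le (z' : R) := @tail_le_of_moments R _ _ _ _ P leb01 _ _ L D N M mp mr C1 D1
  (fun n n0 => let: And3 h _ _ := NP n n0 in h) ME
  (fun n n0 => let: And3 _ _ h := NP n n0 in h) MD' (dist_const C) z' erefl.
have rad_le (z' : R) := @tail_le_of_moments R _ _ _ _ leb01 P _ _ L D M N mr mp C1 D1
  ME (fun n n0 => let: And3 h _ _ := NP n n0 in h)
  (fun n n0 => let: And3 _ h _ := NP n n0 in h) ND (dist_const C) z' erefl.
split; first by rewrite lee_pdivrMl// fin_le.
have := rad_le ((dist_const C)^-1 * z); rewrite mulrA divff ?gt_eqF// mul1r; apply.
by rewrite mulr_gt0// invr_gt0.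
Qed.

End Equivalence.

(* Equivalence 1) <=> 2) <=> 3), with each constant a function of any other
   constant only (uniformly in the probability space, the system, and the
   length N of the system: bound = None is the infinite system, bound = Some N
   the finite system {f_n}_{n=1}^N). *)
Theorem theorem2p1 (R : realType) :
  exists (p12 p13 p21 p23 p31 p32 : R -> R),
  forall (d : measure_display) (T : measurableType d) (P : probability T R)
         (f : nat -> T -> R) (bound : option nat),
    (forall n, measurable_fun setT (f n)) ->
    (forall C, dist_equiv_const P f leb01 rademacher bound C ->
       Lt_equiv_const P f bound (p12 C) /\ K_equiv_const P f bound (p13 C)) /\
    (forall C, Lt_equiv_const P f bound C ->
       dist_equiv_const P f leb01 rademacher bound (p21 C) /\
       K_equiv_const P f bound (p23 C)) /\
    (forall beta, K_equiv_const P f bound beta ->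
       dist_equiv_const P f leb01 rademacher bound (p31 beta) /\
       Lt_equiv_const P f bound (p32 beta)).
Proof.
(* Conditions 1) and 3) are linked through 2), so [p13] and [p31] are compositions. *)
exists (fun C => Num.max 1 C * C),
  (fun C => Num.max 1 (Num.max 1 C * C) * (9 * radA)), dist_const,
  (fun C => Num.max 1 C * (9 * radA)), (fun beta => dist_const (beta * (9 * radA))),
  (fun beta => beta * (9 * radA)).
move=> d T P f bound mf; split=> [C /(Lt_equiv_of_dist P f mf) HL|].
  by split=> //; exact: K_equiv_of_Lt.
split=> [C HL|beta /(Lt_equiv_of_K P f) HL].
  by split; [exact: dist_equiv_of_Lt|exact: K_equiv_of_Lt].
by split=> //; exact: dist_equiv_of_Lt.
Qed.
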